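(* Suppose that the lower level set $\{x\in\mathbb{E}\mid F(x)\le F(x^0)\}$ is bounded. Let $\{x^k\}_{k\ge0}$ be an infinite sequence generated by the parameter-free generalized conditional gradient method described in the context, applied to $\min_{x\in\mathbb{E}}F(x)=f(x)+g(x)$ from the starting point $x^0\in\operatorname{dom} g$. Then there exists an accumulation point $x^*$ of $\{x^k\}$ that is a stationary point of this problem (i.e. $x^*\in\operatorname{dom} g$ and $-\nabla f(x^* )\in\partial g(x^* )$), and $$\lim_{k\to\infty}\min_{0\le l\le k}G(x^l)=0.$$
   Context: Setting. $\mathbb{E}$ is a finite-dimensional real inner product space with inner product $\langle\cdot,\cdot\rangle$ and induced norm $\|\cdot\|$. For $\phi:\mathbb{E}\to(-\infty,\infty]$, $\operatorname{dom}\phi=\{x\mid\phi(x)<\infty\}$; $\phi$ is supercoercive if $\lim_{\|x\|\to\infty}\phi(x)/\|x\|=\infty$. Standing assumptions: $f:\mathbb{E}\to(-\infty,\infty]$ is lower semicontinuous and continuously differentiable on $\operatorname{dom} g$ (i.e. at each point of $\operatorname{dom} g$, $f$ is finite in a neighborhood and differentiable, and $\nabla f:\operatorname{dom} g\to\mathbb{E}$ is continuous); $g:\mathbb{E}\to(-\infty,\infty]$ is a proper closed convex function that is supercoercive; $F:=f+g$ is bounded from below. $\partial g$ is the convex subdifferential. Frank--Wolfe gap. For $x\in\operatorname{dom} g$, $G(x):=\max_{v\in\mathbb{E}}\{\langle\nabla f(x),x-v\rangle+g(x)-g(v)\}\ge 0$; the maximum is attained by supercoerciveness of $g$, exactly at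 the points of $\operatorname{argmin}_{v\in\mathbb{E}}\{\langle\nabla f(x),v\rangle+g(v)\}\neq\emptyset$. Parameter-free generalized conditional gradient method. Input: $x^0\in\operatorname{dom} g$, $L_{-1}>0$. For $k=0,1,2,\ldots$: choose any $v^k\in\operatorname{argmin}_{x\in\mathbb{E}}\{\langle\nabla f(x^k),x\rangle+g(x)\}$ and set $d^k=v^k-x^k$; for $i\in\{0,1,2,\ldots\}$ let $L_k^{(i)}=2^{i-1}L_{k-1}$, $\tau_k^{(i)}=\min\{1,\,G(x^k)/(2L_k^{(i)}\|d^k\|^2)\}$ (if $d^k=0$, then $G(x^k)=0$ and the quotient $0/0$ is taken to be $0$), and $x^{k,i}=x^k+\tau_k^{(i)}d^k$; find the smallest $i\in\{0,1,2,\ldots\}$ such that $$F(x^{k,i})\le F(x^k)-\tfrac12\tau_k^{(i)}G(x^k)+\tfrac12L_k^{(i)}(\tau_k^{(i)})^2\|d^k\|^2;$$ for this $i$ set $x^{k+1}=x^{k,i}$, $L_k=L_k^{(i)}$, $\tau_k=\tau_k^{(i)}$. An infinite sequence generated by the method is one for which all these steps are carried out for every $k\ge0$. *)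

(* Defs.v *)
From HB Require Import structures.
From mathcomp Require Import all_boot all_order all_algebra.
From mathcomp Require Import all_classical all_reals all_analysis.

Set Implicit Arguments.
Unset Strict Implicit.
Unset Printing Implicit Defensive.

Import Order.TTheory GRing.Theory Num.Theory.
Import numFieldNormedType.Exports.

Local Open Scope classical_set_scope.
Local Open Scope ring_scope.

Definition finite_dimensional (R : realType) (E : lmodType R) : Prop :=
  exists (n : nat) (b : 'I_n -> E),
    forall x : E, exists c : 'I_n -> R, x = \sum_(i < n) c i *: b i.

(* A normed space with [norm_induced_by dot] is an inner product space whose
   library topology is the one of the inner product.  *)
Definition norm_induced_by (R : realType) (E : normedModType R)
    (dot : {dot E for idfun}) : Prop :=
  forall x : E, `|x| = Num.sqrt (dot x x).

Definition domain (R : realType) (E : Type) (phi : E -> \bar R) : set E :=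
  [set x | (phi x < +oo)%E].

(* Functions with values in (-oo, +oo].  *)
Definition never_ninfty (R : realType) (E : Type) (phi : E -> \bar R) : Prop :=
  forall x, phi x != -oo%E.

Definition proper_fun (R : realType) (E : Type) (phi : E -> \bar R) : Prop :=
  never_ninfty phi /\ domain phi !=set0.

Definition closed_fun (R : realType) (E : normedModType R)
    (phi : E -> \bar R) : Prop :=
  closed [set p : E * R | (phi p.1 <= p.2%:E)%E].

Definition convex_fun (R : realType) (E : lmodType R)
    (phi : E -> \bar R) : Prop :=
  forall (x y : E) (t : R), 0 < t < 1 ->
    (phi (t *: x + (1 - t) *: y)%R <= t%:E * phi x + (1 - t)%R%:E * phi y)%E.

Definition supercoercive (R : realType) (E : normedModType R)
    (phi : E -> \bar R) : Prop :=
  forall M : R, exists r : R, forall x : E, r < `|x| ->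
    (M%:E < phi x * (`|x|^-1)%:E)%E.

Definition bounded_below (R : realType) (E : Type) (phi : E -> \bar R) : Prop :=
  exists m : R, forall x, (m%:E <= phi x)%E.

Definition is_gradient (R : realType) (E : normedModType R)
    (dot : {dot E for idfun}) (f : E -> \bar R) (x w : E) : Prop :=
  differentiable (fine \o f) x /\
  forall h : E, 'd (fine \o f) x h = dot w h.

(* The unique w with [is_gradient dot f x w] when E is finite-dimensional and
   [fine \o f] is differentiable at x.  *)
Definition gradient (R : realType) (E : normedModType R)
    (dot : {dot E for idfun}) (f : E -> \bar R) (x : E) : E :=
  xget 0 [set w | is_gradient dot f x w].

Definition continuously_differentiable_on (R : realType) (E : normedModType R)
    (dot : {dot E for idfun}) (f : E -> \bar R) (D : set E) : Prop :=
  (forall x, D x -> (\forall y \near x, f y \is a fin_num) /\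
                    differentiable (fine \o f) x) /\
  {within D, continuous (gradient dot f)}.

Definition argmin (R : realType) (E : Type) (phi : E -> \bar R) : set E :=
  [set v | forall y, (phi v <= phi y)%E].

Definition subdifferential (R : realType) (E : normedModType R)
    (dot : {dot E for idfun}) (phi : E -> \bar R) (x : E) : set E :=
  [set s | forall y, (phi x + (dot s (y - x)%R)%:E <= phi y)%E].

Definition stationary_point (R : realType) (E : normedModType R)
    (dot : {dot E for idfun}) (f g : E -> \bar R) (x : E) : Prop :=
  domain g x /\ subdifferential dot g x (- gradient dot f x).

Definition lin_model (R : realType) (E : normedModType R)
    (dot : {dot E for idfun}) (f g : E -> \bar R) (x v : E) : \bar R :=
  ((dot (gradient dot f x) v)%:E + g v)%E.

(* The supremum is attained, hence finite, at every x in [domain g] as soon as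
   g is proper, closed, convex and supercoercive.  *)
Definition fw_gap (R : realType) (E : normedModType R)
    (dot : {dot E for idfun}) (f g : E -> \bar R) (x : E) : \bar R :=
  ereal_sup
    (range (fun v => (dot (gradient dot f x) (x - v)%R)%:E + g x - g v)%E).

Definition trial_L (R : realType) (Lprev : R) (i : nat) : R :=
  2 ^ (i%:Z - 1) * Lprev.

(* For d = 0 the quotient is 0, since 0^-1 = 0.  *)
Definition trial_tau (R : realType) (E : normedModType R)
    (gap L : R) (d : E) : R :=
  Num.min 1 (gap / (2 * L * `|d| ^+ 2)).

Definition trial_point (R : realType) (E : normedModType R)
    (dot : {dot E for idfun}) (f g : E -> \bar R)
    (x v : E) (Lprev : R) (i : nat) : E :=
  x + trial_tau (fine (fw_gap dot f g x)) (trial_L Lprev i) (v - x) *: (v - x).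

Definition sufficient_decrease (R : realType) (E : normedModType R)
    (dot : {dot E for idfun}) (f g : E -> \bar R)
    (x v : E) (Lprev : R) (i : nat) : Prop :=
  let F := (f \+ g)%E in
  let d := v - x in
  let gap := fine (fw_gap dot f g x) in
  let L := trial_L Lprev i in
  let tau := trial_tau gap L d in
  (F (trial_point dot f g x v Lprev i)
     <= F x - (2^-1 * tau * gap)%R%:E
       + (2^-1 * L * tau ^+ 2 * `|d| ^+ 2)%R%:E)%E.

Definition gcg_step (R : realType) (E : normedModType R)
    (dot : {dot E for idfun}) (f g : E -> \bar R)
    (x : E) (Lprev : R) (xnext : E) (L : R) : Prop :=
  exists2 v, argmin (lin_model dot f g x) v &
  exists i : nat,
    [/\ sufficient_decrease dot f g x v Lprev i,
        forall j, (j < i)%N -> ~ sufficient_decrease dot f g x v Lprev j,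
        xnext = trial_point dot f g x v Lprev i
      & L = trial_L Lprev i].

(* [L k] is the estimate L_{k-1}, so that [L 0] is the input L_{-1}.  *)
Definition gcg_sequence (R : realType) (E : normedModType R)
    (dot : {dot E for idfun}) (f g : E -> \bar R)
    (x0 : E) (Linit : R) (x : nat -> E) : Prop :=
  x 0%N = x0 /\
  exists L : nat -> R, L 0%N = Linit /\
    forall k, gcg_step dot f g (x k) (L k) (x k.+1) (L k.+1).

(* Main.v *)
(* The level set {F <= F(x^0)} is closed by lower semicontinuity, hence compact,
   and it lies in dom g; so the gradients are bounded and uniformly continuous
   there, and supercoercivity of g bounds the directions d^k.  Each step lowers
   F by at least tau_k G(x^k) / 4, so tau_k G(x^k) -> 0.  If G(x^k) >= delta > 0
   from some index on, then tau_k -> 0; but by the mean value theorem and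
   uniform continuity every sufficiently small step is accepted, and a rejected
   trial step is at most twice the accepted one, so eventually the first trial
   is always accepted.  Then L_k decreases, which bounds tau_k away from 0: a
   contradiction.  Hence G is arbitrarily small along the tail of the sequence,
   and a cluster point of a subsequence with G -> 0 is stationary by continuity
   of the gradient and lower semicontinuity of g. *)
Require Import Defs.
From HB Require Import structures.
From mathcomp Require Import all_boot all_order all_algebra.
From mathcomp Require Import all_classical all_reals all_analysis.
From mathcomp Require Import ring lra.
Import Order.TTheory GRing.Theory Num.Theory.
Import numFieldNormedType.Exports.
Local Open Scope classical_set_scope.
Local Open Scope ring_scope.

Lemma bounded_set_norm_le {R : realType} {E : normedModType R} (A : set E) :
  bounded_set A -> exists M, forall x, A x -> `|x| <= M.
Proof.
by case=> M [_ AM]; exists (M + 1) => x Ax; apply: AM => //; rewrite ltrDl.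
Qed.

(** * Finite-dimensional inner product spaces *)

Section inner_product.
Context {R : realType} {E : normedModType R} (dot : {dot E for idfun}).
Implicit Types (u v w x y : E) (t : seq E).

Lemma dotC u v : dot u v = dot v u.
Proof. by rewrite hermC expr0 mul1r. Qed.

Lemma dotDl u v w : dot (u + v) w = dot u w + dot v w.
Proof. exact: linearDl. Qed.

Lemma dotBl u v w : dot (u - v) w = dot u w - dot v w.
Proof. exact: linearBl. Qed.

Lemma dotZl a u w : dot (a *: u) w = a * dot u w.
Proof. exact: linearZl_LR. Qed.

Lemma dotDr w u v : dot w (u + v) = dot w u + dot w v.
Proof. exact: linearDr. Qed.

Lemma dotNr w u : dot w (- u) = - dot w u.
Proof. exact: linearNr. Qed.

Lemma dotBr w u v : dot w (u - v) = dot w u - dot w v.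
Proof. exact: linearBr. Qed.

Lemma dotZr w a u : dot w (a *: u) = a * dot w u.
Proof. exact: linearZr. Qed.

Lemma dot0r w : dot w 0 = 0.
Proof. exact: linear0r. Qed.

Lemma dot_sumr (I : Type) (r : seq I) (F : I -> E) w :
  dot w (\sum_(i <- r) F i) = \sum_(i <- r) dot w (F i).
Proof. exact: linear_sum. Qed.

Lemma dot_ge0 u : 0 <= dot u u.
Proof.
by have [->|/neq0_dnorm_gt0/ltW//] := eqVneq u 0; rewrite dot0r.
Qed.

(* The orthogonal projection on the span of [t] only if [t] is orthonormal up
   to zero vectors, as in [gram_schmidt]. *)
Definition proj t x : E := \sum_(e <- t) dot x e *: e.

Lemma projB t x y : proj t (x - y) = proj t x - proj t y.
Proof.
rewrite /proj -sumrB; apply: eq_bigr => e _.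
by rewrite dotBl scalerBl.
Qed.

Lemma projZ t a x : proj t (a *: x) = a *: proj t x.
Proof.
by rewrite /proj scaler_sumr; apply: eq_bigr => e _; rewrite dotZl scalerA.
Qed.

Lemma proj_sum t (I : Type) (r : seq I) (F : I -> E) :
  proj t (\sum_(i <- r) F i) = \sum_(i <- r) proj t (F i).
Proof.
rewrite /proj exchange_big; apply: eq_bigr => e _.
by rewrite dotC dot_sumr scaler_suml; apply: eq_bigr => i _; rewrite dotC.
Qed.

Lemma dot_proj t x y : dot (proj t x) y = dot x (proj t y).
Proof.
rewrite dotC !dot_sumr; apply: eq_bigr => e _.
by rewrite !dotZr mulrC (dotC y).
Qed.

(** Orthonormality is kept only through [proj]: unit bound and fixed vectors are all that is used
    later. As [proj t] is self-adjoint and idempotent, the residual [u] of [b] is orthogonal to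
    every vector fixed by [proj t], so its normalization can be added to [t]. *)
Lemma gram_schmidt (s : seq E) : exists t,
  (forall e, e \in t -> dot e e <= 1 /\ proj t e = e) /\
  (forall b, b \in s -> proj t b = b).
Proof.
elim: s => [|b s [t [t1 ts]]]; first by exists [::]; split.
have PP x : proj t (proj t x) = proj t x.
  rewrite -[LHS]/(proj t (\sum_(e <- t) dot x e *: e)) proj_sum.
  by apply: eq_big_seq => e /t1[_ Pe]; rewrite projZ Pe.
pose u := b - proj t b.
have [u0|u0] := eqVneq u 0.
  exists t; split=> // c; rewrite inE => /orP[/eqP ->|/ts//].
  by apply/esym/eqP; rewrite -subr_eq0 -/u u0.
have uu : 0 < dot u u by exact: neq0_dnorm_gt0.
pose e := (Num.sqrt (dot u u))^-1 *: u.
have s2 : (Num.sqrt (dot u u))^-1 * (Num.sqrt (dot u u))^-1 = (dot u u)^-1.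
  by rewrite -invfM -expr2 sqr_sqrtr// ltW.
have ee : dot e e = 1 by rewrite dotZr dotZl mulrA s2 mulVf ?gt_eqF.
have we w : proj t w = w -> dot w e = 0.
  by move=> Pw; rewrite dotZr (dotBr w) -dot_proj Pw subrr mulr0.
have Pwe w : proj t w = w -> proj (e :: t) w = w.
  by move=> Pw; rewrite /proj big_cons we// scale0r add0r.
exists (e :: t); split=> c; rewrite inE => /orP[/eqP ->|].
- rewrite ee; split=> //.
  rewrite /proj big_cons ee scale1r -/(proj t e).
  by rewrite projZ projB PP subrr scaler0 addr0.
- by move=> /t1[? Pc]; split=> //; exact: Pwe.
- rewrite /proj big_cons -/(proj t b).
  have -> : dot b e = dot u e by rewrite dotBl (we (proj t b)) ?subr0.
  by rewrite dotZr scalerA mulrAC s2 mulVf ?gt_eqF// scale1r subrK.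
- by move=> /ts; exact: Pwe.
Qed.

Hypothesis E_norm : norm_induced_by dot.

Lemma sqr_normE x : `|x| ^+ 2 = dot x x.
Proof. by rewrite E_norm sqr_sqrtr// dot_ge0. Qed.

Lemma dot_le_norm x y : dot x y <= `|x| * `|y|.
Proof.
have : `|x + y| ^+ 2 <= (`|x| + `|y|) ^+ 2.
  by rewrite ler_pXn2r ?nnegrE ?addr_ge0// ler_normD.
rewrite sqrrD !sqr_normE dotDl !dotDr (dotC y x) -mulr_natr; lra.
Qed.

Lemma cauchy_schwarz x y : `|dot x y| <= `|x| * `|y|.
Proof.
by rewrite ler_norml dot_le_norm andbT lerNl -dotNr -(normrN y) dot_le_norm.
Qed.

Hypothesis E_finite : finite_dimensional E.

Lemma proj_total : exists t, (forall e, e \in t -> `|e| <= 1) /\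
  forall x, proj t x = x.
Proof.
have [n [b bE]] := E_finite.
have [t [t1 tb]] := gram_schmidt [seq b i | i <- enum 'I_n].
exists t; split=> [e /t1[+ _]|x].
  by rewrite -sqr_normE -[leRHS](expr1n _ 2) ler_pXn2r ?nnegrE.
have [c ->] := bE x; rewrite proj_sum; apply: eq_bigr => i _.
by rewrite projZ tb// map_f// mem_enum.
Qed.

(** Heine-Borel: by Cauchy-Schwarz the coordinates [dot x e] of a bounded set lie in a cube, and [A]
    is a closed subset of the continuous image of that compact cube. *)
Lemma closed_bounded_compact (A : set E) :
  closed A -> bounded_set A -> compact A.
Proof.
move=> Acl /bounded_set_norm_le[M AM]; have [t [t1 tE]] := proj_total.
pose phi (v : 'rV[R]_(size t)) : E := \sum_i v ord0 i *: t`_i.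
pose B := [set v : 'rV[R]_(size t) | forall i, v ord0 i \in `[(- M), M]].
have Bco : compact B.
  by apply: (@rV_compact _ _ (fun=> `[(- M), M]%classic)) => i;
    exact: segment_compact.
have phic : continuous phi.
  apply: continuous_big => [|i _ v]; first exact: add_continuous.
  by apply: (@cvgZr_tmp _ _ _ (nbhs v)); exact: coord_continuous.
have phiB := continuous_compact (continuous_subspaceT phic) Bco.
apply: (subclosed_compact Acl phiB).
move=> x Ax; exists (\row_i dot x t`_i).
  move=> i; rewrite mxE in_itv/= -ler_norml.
  rewrite (le_trans (cauchy_schwarz _ _))// (le_trans _ (AM x Ax))//.
  by rewrite ler_piMr// t1// mem_nth.
rewrite /phi -[RHS]tE /proj (big_nth 0) big_mkord.
by apply: eq_bigr => i _; rewrite mxE.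
Qed.

(** Riesz representation: the values of the differential on the vectors of [t] are the coordinates
    of the gradient. *)
Lemma gradientP (f : E -> \bar R) x :
  differentiable (fine \o f) x -> is_gradient dot f x (gradient dot f x).
Proof.
move=> df; apply: (xgetPex 0).
have [t [_ tE]] := proj_total.
exists (\sum_(e <- t) 'd (fine \o f) x e *: e); split=> // h.
rewrite -[in LHS](tE h) linear_sum dotC dot_sumr.
by apply: eq_bigr => e _; rewrite linearZ dotZr mulrC.
Qed.

End inner_product.

(** * Lower semicontinuity and continuous gradients *)

Lemma closed_fun_lsc {R : realType} {E : normedModType R} (g : E -> \bar R) :
  closed_fun g -> lower_semicontinuous g.
Proof.
move=> gc x a agx.
have : nbhs (x, a) (~` [set p : E * R | (g p.1 <= p.2%:E)%E]).
  by apply: open_nbhs_nbhs; split; [exact: closed_openC|rewrite /= leNgt agx].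
case=> -[A B] /= [xA aB] AB; exists A => // y Ay.
have := AB (y, a) (conj Ay (nbhs_singleton aB)).
by rewrite /= leNgt => /negP; rewrite negbK.
Qed.

Lemma lsc_level_closed {R : realType} {E : normedModType R}
    (phi : E -> \bar R) (a : R) :
  lower_semicontinuous phi -> closed [set x | (phi x <= a%:E)%E].
Proof.
move=> /lower_semicontinuousP phi_lsc.
rewrite (_ : mkset _ = ~` [set x | (a%:E < phi x)%E]); first exact: open_closedC.
by apply/seteqP; split => x /=; rewrite leNgt => /negP.
Qed.

Lemma lower_semicontinuousD {R : realType} {E : normedModType R}
    (f g : E -> \bar R) :
  never_ninfty f -> never_ninfty g ->
  lower_semicontinuous f -> lower_semicontinuous g ->
  lower_semicontinuous (f \+ g)%E.
Proof.
move=> fN gN fl gl x a /= afg.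
(* When both values are finite, half of the excess [r + s - a] is taken off each. When one is
   infinite, the finite one is lowered by [1] and the other bound makes up for it. *)
have [p [q [pf qg apq]]] : exists p q : R,
    [/\ (p%:E < f x)%E, (q%:E < g x)%E & a <= p + q].
  move: afg (fN x) (gN x).
  case: (f x) (g x) => [r| |] [s| |]//= h _ _.
  - exists (r - (r + s - a) / 2), (s - (r + s - a) / 2).
    by move: h; rewrite -EFinD !lte_fin => h; split; lra.
  - exists (r - 1), (a - r + 1); rewrite lte_fin ltry; split=> //; lra.
  - exists (a - s + 1), (s - 1); rewrite lte_fin ltry; split=> //; lra.
  - by exists a, 0; rewrite !ltry addr0.
have [U xU fU] := fl x p pf; have [V xV gV] := gl x q qg.
exists (U `&` V); first exact: filterI.
move=> y [/fU fy /gV gy].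
by rewrite (@le_lt_trans _ _ (p%:E + q%:E)%E) ?lteD// -EFinD lee_fin.
Qed.

(** Only one of the two points has to lie in the compact set: trial segments start in the level set
    but may leave it while staying in the domain of [g]. *)
Lemma compact_uniform_continuity {R : realType} {E V : normedModType R}
    (h : E -> V) (K D : set E) (e : R) :
  compact K -> K `<=` D -> {within D, continuous h} -> 0 < e ->
  exists2 eta, 0 < eta &
    forall x y, K x -> D y -> `|y - x| < eta -> `|h y - h x| < e.
Proof.
move=> Kco KD /subspace_continuousP hD e0.
pose P (eta : R) x := forall y, D y -> `|y - x| < eta -> `|h y - h x| < e.
have : \forall eta \near (0 : R)^'+, K `<=` P eta.
  move/compact_near_coveringP/near_covering_withinP : Kco; apply => x Kx.
  have /cvgrPdist_lt/(_ _ (divr_gt0 e0 (ltr0Sn R 1))) := hD x (KD x Kx).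
  move=> /nbhs_ballP[d /= d0 xd].
  have d2 : 0 < d / 2 by rewrite divr_gt0.
  exists (ball x (d / 2), [set eta | eta < d / 2]) => /=.
    by split; [exact: nbhsx_ballx|exact: nbhs_right_lt].
  move=> [x' eta] /= [xx' etad] Kx' y Dy yx'.
  have hx' : `|h x - h x'| < e / 2.
    by apply: xd (KD _ Kx'); apply: le_ball xx'; lra.
  have hy : `|h x - h y| < e / 2.
    apply: xd Dy; rewrite -ball_normE /ball_/=.
    rewrite (splitr d) -(subrKA x') (le_lt_trans (ler_normD _ _))//.
    move: xx'; rewrite -ball_normE /= => xx'.
    by rewrite ltrD// (distrC x') (lt_trans yx').
  rewrite (splitr e) -(subrKA (h x)) (le_lt_trans (ler_normD _ _))//.
  by rewrite ltrD// distrC.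
move=> /(filterI (nbhs_right_gt (0 : R)))/filter_ex[eta [eta0 KP]].
by exists eta => // x y Kx; exact: KP.
Qed.

Lemma continuous_within_compact_bounded {R : realType} {E V : normedModType R}
    (h : E -> V) (K D : set E) :
  compact K -> K `<=` D -> {within D, continuous h} ->
  exists M, forall x, K x -> `|h x| <= M.
Proof.
move=> Kco KD hD.
have /compact_bounded/bounded_set_norm_le[M hM] :=
  continuous_compact (continuous_subspaceW KD hD) Kco.
by exists M => x Kx; apply: hM; exists x.
Qed.

(** The one-dimensional mean value theorem applied to [f] along the segment, with the derivative
    given by the chain rule. *)
Lemma gradient_mean_value {R : realType} {E : normedModType R}
    (dot : {dot E for idfun}) (f : E -> \bar R) (D : set E) (x d : E) (tau : R) :
  norm_induced_by dot -> finite_dimensional E ->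
  (forall y, D y -> differentiable (fine \o f) y) ->
  0 < tau -> (forall t, 0 <= t <= tau -> D (x + t *: d)) ->
  exists2 c, 0 <= c <= tau &
    fine (f (x + tau *: d)) - fine (f x)
      = tau * dot (gradient dot f (x + c *: d)) d.
Proof.
move=> E_norm E_finite f_diff tau0 Dseg.
pose phi (t : R) : R := fine (f (x + t *: d)).
have phiD (t : R) : 0 <= t <= tau ->
    is_derive t 1 phi (dot (gradient dot f (x + t *: d)) d).
  move=> ht.
  have lin : is_diff t (fun s : R => x + s *: d) (fun s : R => s *: d).
    by have := is_diffD (is_diff_cst x t) (is_diff_scalel t d); rewrite add0r.
  have df := f_diff _ (Dseg t ht).
  have dphi : is_diff t phi ('d (fine \o f) (x + t *: d) \o (fun s : R => s *: d)).
    exact: is_diff_comp lin (differentiableP df).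
  have [dp dphiE] := dphi.
  apply: DeriveDef; first exact: diff_derivable.
  rewrite deriveE// dphiE /= scale1r.
  by have [_ ->] := gradientP dot E_norm E_finite _ _ df.
have [||c] := MVT_segment (ltW tau0) (f := phi)
    (df := fun t => dot (gradient dot f (x + t *: d)) d).
- by move=> t /[!in_itv]/= /andP[/ltW t0 /ltW t1]; apply: phiD; rewrite t0 t1.
- apply: derivable_within_continuous => t /[!in_itv]/= ht.
  by have [] := phiD t ht.
rewrite in_itv /= => hc; rewrite /phi subr0 scale0r addr0 => ->.
by exists c => //; rewrite mulrC.
Qed.

(** * The generalized conditional gradient method *)

Section conditional_gradient.
Context {R : realType} {E : normedModType R} (dot : {dot E for idfun}).
Hypothesis E_finite : finite_dimensional E.
Hypothesis E_norm : norm_induced_by dot.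
Variables f g : E -> \bar R.
Hypothesis f_C1 : continuously_differentiable_on dot f (domain g).
Hypothesis g_proper : proper_fun g.
Hypothesis g_closed : closed_fun g.
Hypothesis g_convex : convex_fun g.
Hypothesis g_supercoercive : supercoercive g.

Let h := gradient dot f.
Let fr x := fine (f x).
Let gr x := fine (g x).
Let Fr x := fr x + gr x.
Let gap x := fine (fw_gap dot f g x).
Let lmo x v := argmin (lin_model dot f g x) v.

Lemma f_fine x : domain g x -> f x = (fr x)%:E.
Proof.
by move=> /f_C1.1[/nbhs_singleton fx _]; rewrite fineK.
Qed.

Lemma g_fine x : domain g x -> g x = (gr x)%:E.
Proof.
rewrite /domain /= => gx; rewrite fineK//.
by rewrite fin_numE g_proper.1 lt_eqF.
Qed.

Lemma domain_fin x (a : R) : (g x <= a%:E)%E -> domain g x.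
Proof. by move=> gx; rewrite /domain /= (le_lt_trans gx)// ltry. Qed.

Lemma g_segment x y (t : R) : domain g x -> domain g y -> 0 <= t <= 1 ->
  domain g (x + t *: (y - x)) /\
  gr (x + t *: (y - x)) <= gr x + t * (gr y - gr x).
Proof.
move=> Dx Dy /andP[]; rewrite [0 <= t]le_eqVlt => /orP[/eqP<- _|t0].
  by rewrite scale0r mul0r !addr0.
rewrite le_eqVlt => /orP[/eqP->|t1]; first by rewrite scale1r mul1r !subrKC.
have -> : x + t *: (y - x) = t *: y + (1 - t) *: x.
  by rewrite scalerBr scalerBl scale1r addrCA addrA.
have := g_convex y x t; rewrite t0 t1 => /(_ isT).
rewrite (g_fine x)// (g_fine y)// -!EFinM -EFinD => gt.
have Dt := domain_fin _ _ gt; split=> //.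
by move: gt; rewrite (g_fine _ Dt) lee_fin; lra.
Qed.

Lemma lmoP x v : domain g x -> lmo x v -> domain g v /\
  forall y, domain g y -> dot (h x) v + gr v <= dot (h x) y + gr y.
Proof.
move=> Dx xv.
have Dv : domain g v.
  have := xv x; rewrite /lin_model (g_fine _ Dx) -EFinD => gv.
  rewrite /domain /= ltNge leye_eq; apply: contraTN gv => /eqP ->.
  by rewrite addey// leye_eq.
split=> // y Dy; have := xv y.
by rewrite /lin_model (g_fine _ Dy) (g_fine _ Dv) -!EFinD lee_fin.
Qed.

(** Maximizing the gap expression amounts to minimizing the linear model, so [v] attains the
    supremum. *)
Lemma fw_gapE x v : domain g x -> lmo x v ->
  fw_gap dot f g x = (dot (h x) (x - v) + gr x - gr v)%:E.
Proof.
move=> Dx xv; have [Dv vmin] := lmoP _ _ Dx xv.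
apply/eqP; rewrite eq_le; apply/andP; split.
  apply: ge_ereal_sup => _ [y _ <-]; rewrite (g_fine _ Dx).
  have [gy|Dy] := eqVneq (g y) +oo%E; first by rewrite gy leNye.
  have {}Dy : domain g y by rewrite /domain /= ltey.
  rewrite (g_fine _ Dy) -!EFinD lee_fin.
  by have := vmin y Dy; rewrite !(dotBr _ (h x)); lra.
apply: ereal_sup_ubound; exists v => //.
by rewrite (g_fine _ Dx) (g_fine _ Dv) -!EFinD.
Qed.

Lemma gapE x v : domain g x -> lmo x v ->
  gap x = dot (h x) (x - v) + gr x - gr v.
Proof. by move=> Dx xv; rewrite /gap (fw_gapE _ v). Qed.

Lemma fw_gap_fine x v : domain g x -> lmo x v -> fw_gap dot f g x = (gap x)%:E.
Proof. by move=> Dx xv; rewrite /gap (fw_gapE _ v). Qed.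

Lemma gap_ge0 x v : domain g x -> lmo x v -> 0 <= gap x.
Proof.
move=> Dx xv; rewrite (gapE _ v)//.
by have := (lmoP _ _ Dx xv).2 x Dx; rewrite dotBr; lra.
Qed.

Lemma gap_gt0_neq x v : domain g x -> lmo x v -> 0 < gap x -> 0 < `|v - x|.
Proof.
move=> Dx xv; rewrite (gapE _ v)// normr_gt0 subr_eq0.
by apply: contraTN => /eqP ->; rewrite subrr dot0r add0r subrr ltxx.
Qed.

(** * Step sizes and the acceptance test *)

Let tau x v L := trial_tau (gap x) L (v - x).

(** Real-valued form of [sufficient_decrease], parametrized by the estimate rather than the trial
    index, so that it also speaks of [L / 2]. *)
Let accepted x v L :=
  Fr (x + tau x v L *: (v - x)) <= Fr x - 2^-1 * tau x v L * gap x
    + 2^-1 * L * tau x v L ^+ 2 * `|v - x| ^+ 2.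

Lemma tau01 x v L : domain g x -> lmo x v -> 0 < L -> 0 <= tau x v L <= 1.
Proof.
move=> Dx xv L0; rewrite /tau /trial_tau ge_min lexx andbT le_min ler01/=.
by rewrite divr_ge0 ?(gap_ge0 _ v)// mulr_ge0 ?sqr_ge0// mulr_ge0// ltW.
Qed.

(** The cap on the step size makes the quadratic term of the test consume at most half of the linear
    one; an accepted step thus gains [tau * gap / 4]. *)
Lemma tau_quadratic x v L : domain g x -> lmo x v -> 0 < L ->
  L * tau x v L ^+ 2 * `|v - x| ^+ 2 <= tau x v L * gap x / 2.
Proof.
move=> Dx xv L0; have /andP[t0 _] := tau01 x v L Dx xv L0.
suff : tau x v L * (2 * L * `|v - x| ^+ 2) <= gap x.
  by move/(ler_wpM2l t0); rewrite expr2; lra.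
have [->|d0] := eqVneq (v - x) 0.
  by rewrite normr0 expr0n/= !mulr0 (gap_ge0 _ v).
rewrite -ler_pdivlMr; first by rewrite ge_min lexx orbT.
by rewrite mulr_gt0 ?exprn_gt0 ?normr_gt0// mulr_gt0.
Qed.

(* A rejected trial at [L / 2] has [tau0 <= tau x v (L / 2)], hence the step
   accepted at [L] is still at least [tau0 / 2]. *)
Lemma tau_half x v L : tau x v (L / 2) <= 2 * tau x v L.
Proof.
rewrite /tau /trial_tau; set a := `|_| ^+ 2.
have -> : gap x / (2 * (L / 2) * a) = 2 * (gap x / (2 * L * a)).
  have -> : 2 * (L / 2) = L by lra.
  rewrite !invfM; lra.
set Y := gap x / _.
by case: (leP 1 Y) => ?; case: (leP 1 (2 * Y)) => ?; lra.
Qed.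

Lemma sufficient_decreaseP x v Lprev i : domain g x -> lmo x v -> 0 < Lprev ->
  sufficient_decrease dot f g x v Lprev i <-> accepted x v (trial_L Lprev i).
Proof.
move=> Dx xv L0; have [Dv _] := lmoP _ _ Dx xv.
have L'0 : 0 < trial_L Lprev i by rewrite mulr_gt0// exprz_gt0.
have [Dt _] := g_segment _ _ _ Dx Dv (tau01 x v _ Dx xv L'0).
rewrite /sufficient_decrease /trial_point /accepted -/(gap x).
rewrite -/(tau x v (trial_L Lprev i)) /= (f_fine _ Dt) (g_fine _ Dt).
rewrite (f_fine _ Dx) (g_fine _ Dx) -!EFinD lee_fin.
by [].
Qed.

(** The final alternative encodes minimality of [i]: either the first trial was accepted, or the
    trial just before, at [L / 2], was rejected. *)
Lemma gcg_stepP x Lprev x' L : domain g x -> 0 < Lprev ->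
  gcg_step dot f g x Lprev x' L ->
  exists2 v, lmo x v & [/\ domain g x', 0 < L,
    tau x v L * gap x / 4 <= Fr x - Fr x' &
    L = Lprev / 2 \/ ~ accepted x v (L / 2)].
Proof.
move=> Dx Lprev0 [v xv [i [dec bt -> ->]]]; exists v => //.
have [Dv _] := lmoP _ _ Dx xv.
have L0 : 0 < trial_L Lprev i by rewrite mulr_gt0// exprz_gt0.
have [Dt _] := g_segment _ _ _ Dx Dv (tau01 x v _ Dx xv L0).
split=> //.
- have /(sufficient_decreaseP _ _ _ _ Dx xv Lprev0) := dec.
  rewrite /accepted /trial_point -/(gap x) -/(tau x v (trial_L Lprev i)).
  have := tau_quadratic x v _ Dx xv L0; lra.
(* Trial [0] has exponent [-1], so it already halves the previous estimate. *)
- case: i {dec L0 Dt} bt => [_|i bt]; [left|right].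
    by rewrite /trial_L sub0r exprN1 mulrC.
  have -> : trial_L Lprev i.+1 / 2 = trial_L Lprev i.
    by rewrite /trial_L intS !exprzDr ?unitfE ?pnatr_eq0// expr1z exprN1; lra.
  move=> /(sufficient_decreaseP _ _ _ _ Dx xv Lprev0); exact: bt.
Qed.

(** * Uniform estimates on a compact part of the domain *)

Variable K : set E.
Hypothesis K_compact : compact K.
Hypothesis K_domain : K `<=` domain g.

Lemma lmo_bounded x0 : domain g x0 ->
  exists2 B, 0 < B & forall x v, K x -> lmo x v -> `|v - x| <= B.
Proof.
move=> Dx0.
have [Mh hM] := continuous_within_compact_bounded h _ _ K_compact K_domain f_C1.2.
have [MK KM] := bounded_set_norm_le _ (compact_bounded K_compact).
(* The slope exceeds the gradient bound by [1]: beyond radius [r], comparing the model at [v] and at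
   [x0] leaves [|v| < c]. *)
have [r gr_large] := g_supercoercive (Mh + 1).
pose c := Mh * `|x0| + gr x0.
exists (`|r| + `|c| + `|MK| + 1).
  by rewrite ltr_wpDl// !addr_ge0.
move=> x v Kx xv; have Dx := K_domain _ Kx; have [Dv vmin] := lmoP _ _ Dx xv.
have v_le : `|v| <= `|r| + `|c|.
  have [//|v_gt] := leP; have v0 : 0 < `|v| by rewrite (le_lt_trans _ v_gt)// addr_ge0.
  have : ((Mh + 1)%:E < g v * (`|v|^-1)%:E)%E.
    apply: gr_large; rewrite (le_lt_trans _ v_gt)// (le_trans (ler_norm r))//.
    by rewrite lerDl.
  rewrite (g_fine _ Dv) -EFinM lte_fin ltr_pdivlMr// => gv.
  have := vmin _ Dx0.
  have := cauchy_schwarz dot E_norm (h x) v; rewrite ler_norml => /andP[+ _].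
  have := dot_le_norm dot E_norm (h x) x0.
  have := ler_wpM2r (normr_ge0 v) (hM x Kx).
  have := ler_wpM2r (normr_ge0 x0) (hM x Kx).
  have := ler_norm c; have := normr_ge0 r; rewrite /c; lra.
rewrite (le_trans (ler_normB _ _))//.
have := KM x Kx; have := ler_norm MK; lra.
Qed.

(** To first order, with convexity of [g], a step [t] lowers [F] by [t * gap x]. Uniform continuity
    of the gradient limits the error to [t * delta / 2], so at least half of the gain remains. The
    threshold [tau0] is independent of [L]. *)
Lemma small_tau_accepted (B delta : R) : 0 < B -> 0 < delta ->
  (forall x v, K x -> lmo x v -> `|v - x| <= B) ->
  exists2 tau0, 0 < tau0 & forall x v L, K x -> lmo x v -> 0 < L ->
    delta <= gap x -> tau x v L < tau0 -> accepted x v L.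
Proof.
move=> B0 delta0 KB.
have e0 : 0 < delta / (2 * B) by rewrite divr_gt0// mulr_gt0.
have [eta eta0 h_unif] :=
  compact_uniform_continuity h _ _ _ K_compact K_domain f_C1.2 e0.
(* As directions have norm at most [B], shorter steps move the point by less than [eta]. *)
exists (eta / B); first by rewrite divr_gt0.
move=> x v L Kx xv L0 gap_delta tau_lt.
have Dx := K_domain _ Kx; have [Dv _] := lmoP _ _ Dx xv.
have t01 := tau01 x v L Dx xv L0; have /andP[+ t1] := t01.
rewrite /accepted; set t := tau x v L in tau_lt t01 t1 *.
rewrite le_eqVlt => /orP[/eqP <-|t0].
  by rewrite scale0r addr0 expr0n/= !(mulr0, mul0r) subr0 addr0.
have seg c : 0 <= c <= t -> domain g (x + c *: (v - x)).
  move=> /andP[c0 ct]; apply: (g_segment _ _ _ Dx Dv _).1.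
  by rewrite c0 (le_trans ct).
have [c ct fc] := gradient_mean_value dot f (domain g) x (v - x) t
  E_norm E_finite (fun y Dy => (f_C1.1 y Dy).2) t0 seg.
have [_ gt] := g_segment _ _ _ Dx Dv t01.
have hc : dot (h (x + c *: (v - x)) - h x) (v - x) <= delta / 2.
  rewrite (le_trans (dot_le_norm dot E_norm _ _))//.
  have -> : delta / 2 = delta / (2 * B) * B by field; rewrite gt_eqF.
  rewrite ler_pM// ?KB// ltW// h_unif//; first exact: seg.
  rewrite addrAC subrr add0r normrZ; case/andP: ct => c0 ct.
  rewrite ger0_norm// -(divfK (lt0r_neq0 B0) eta).
  by rewrite (@le_lt_trans _ _ (t * B)) ?ler_pM ?KB// ltr_pM2r.
have gapD : gap x = - dot (h x) (v - x) + gr x - gr v.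
  by rewrite (gapE _ v)// -(opprB v x) dotNr.
have : 0 <= 2^-1 * L * t ^+ 2 * `|v - x| ^+ 2.
  by rewrite !mulr_ge0 ?sqr_ge0 ?invr_ge0// ltW.
have : t * dot (h (x + c *: (v - x))) (v - x)
    <= t * (dot (h x) (v - x) + gap x / 2).
  by rewrite ler_pM2l//; move: hc; rewrite dotBl; lra.
rewrite -fc /Fr; move: gt; rewrite -/(fr _) -/(fr x).
have : t * gap x = t * (- dot (h x) (v - x) + gr x - gr v) by rewrite gapD.
lra.
Qed.

(** * Iterates of the method and decay of the gap *)

Variables (x : nat -> E) (L : nat -> R).
Hypothesis x0_domain : domain g (x 0).
Hypothesis L0_gt0 : 0 < L 0.
Hypothesis x_step : forall k, gcg_step dot f g (x k) (L k) (x k.+1) (L k.+1).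

Lemma gcg_invariant k : domain g (x k) /\ 0 < L k.
Proof.
by elim: k => // k [Dx Lk]; have [v _ [? ? _ _]] := gcg_stepP _ _ _ _ Dx Lk (x_step k).
Qed.

Lemma gcg_lmo k : exists v, lmo (x k) v.
Proof. by have [v xv _] := x_step k; exists v. Qed.

Lemma gcg_decrease k : exists2 v, lmo (x k) v &
  [/\ tau (x k) v (L k.+1) * gap (x k) / 4 <= Fr (x k) - Fr (x k.+1) &
      L k.+1 = L k / 2 \/ ~ accepted (x k) v (L k.+1 / 2)].
Proof.
have [Dx Lk] := gcg_invariant k.
by have [v ? [_ _ ? ?]] := gcg_stepP _ _ _ _ Dx Lk (x_step k); exists v.
Qed.

Lemma gcg_gap_ge0 k : 0 <= gap (x k).
Proof.
by have [v xv] := gcg_lmo k; apply: gap_ge0 xv; have [] := gcg_invariant k.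
Qed.

Lemma gcg_antitone : {homo Fr \o x : j k / (j <= k)%N >-> k <= j}.
Proof.
apply/nonincreasing_seqP => k /=.
have [v xv [dec _]] := gcg_decrease k.
have [Dx _] := gcg_invariant k; have [_ Lk] := gcg_invariant k.+1.
rewrite -subr_ge0 (le_trans _ dec)// divr_ge0// mulr_ge0 ?gcg_gap_ge0//.
by have /andP[] := tau01 _ _ _ Dx xv Lk.
Qed.

Hypothesis xK : forall k, K (x k).
Variable m : R.
Hypothesis Fr_ge : forall k, m <= Fr (x k).

(** The values of [F] decrease and are bounded below; once they are within [e / 4] of their infimum,
    no later step can gain [e / 4]. *)
Lemma tau_gap_small (e : R) : 0 < e -> exists N, forall k, (N <= k)%N ->
  exists2 v, lmo (x k) v &
    tau (x k) v (L k.+1) * gap (x k) < e /\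
    (L k.+1 = L k / 2 \/ ~ accepted (x k) v (L k.+1 / 2)).
Proof.
move=> e0; have e4 : 0 < e / 4 by rewrite divr_gt0.
pose S := [set Fr (x k) | k in setT].
have Sinf : has_inf S.
  by split; [exists (Fr (x 0)), 0|exists m => _ [k _ <-]].
have [_ [N _ <-] FN] := inf_adherent e4 Sinf.
exists N => k Nk; have [v xv [dec alt]] := gcg_decrease k; exists v => //.
split=> //; have := gcg_antitone _ _ Nk; rewrite /=.
have : inf S <= Fr (x k.+1) by apply: (ge_inf Sinf.2); exists k.+1.
by move: FN dec; lra.
Qed.

Lemma gap_small (delta : R) N : 0 < delta ->
  exists2 k, (N <= k)%N & gap (x k) < delta.
Proof.
move=> delta0; apply: contrapT => no_small.
have gap_ge k : (N <= k)%N -> delta <= gap (x k).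
  by move=> Nk; rewrite leNgt; apply/negP => ?; apply: no_small; exists k.
have Dx k : domain g (x k) by exact: K_domain.
have [B B0 KB] := lmo_bounded _ x0_domain.
have [tau0 tau0_gt0 small_acc] := small_tau_accepted _ _ B0 delta0 KB.
have tau_lt (t : R) : 0 < t -> exists2 M, (N <= M)%N & forall k, (M <= k)%N ->
    exists2 v, lmo (x k) v & tau (x k) v (L k.+1) < t /\
      (L k.+1 = L k / 2 \/ ~ accepted (x k) v (L k.+1 / 2)).
  move=> t0; have [M tauM] := tau_gap_small _ (mulr_gt0 t0 delta0).
  exists (maxn N M) => [|k]; first exact: leq_maxl.
  rewrite geq_max => /andP[Nk /tauM[v xv [tg alt]]]; exists v => //.
  split=> //; rewrite ltNge; apply/negP => t_le; move: tg; rewrite ltNge.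
  by rewrite ler_pM ?gap_ge// ltW.
(* Half of [tau0] because a rejected trial at [L / 2] has up to twice the step; that trial would
   then be below [tau0] and accepted, so only halving remains. *)
have [M NM tauM] := tau_lt _ (divr_gt0 tau0_gt0 (ltr0Sn R 1)).
have L_half k : (M <= k)%N -> L k.+1 = L k / 2.
  move=> Mk; have [v xv [tk [//|[]]]] := tauM k Mk.
  have [_ Lk] := gcg_invariant k.+1.
  apply: small_acc => //; first by rewrite divr_gt0.
    by rewrite gap_ge// (leq_trans NM).
  by rewrite (le_lt_trans (tau_half _ _ _))//; move: tk; lra.
have L_le k : (M <= k)%N -> L k <= L M.
  elim: k => [|k IH]; first by rewrite leqn0 => /eqP ->.
  rewrite leq_eqVlt => /orP[/eqP -> //|]; rewrite ltnS => Mk.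
  rewrite (le_trans _ (IH Mk))// L_half//.
  by have [_] := gcg_invariant k; lra.
have [_ LM] := gcg_invariant M.
have q0 : 0 < 2 * L M * B ^+ 2 by rewrite mulr_gt0 ?exprn_gt0// mulr_gt0.
(* The step size with each quantity at its worst bound: gap [delta], estimate [L M], direction norm
   [B]. *)
pose tau1 := Num.min 1 (delta / (2 * L M * B ^+ 2)).
have tau1_gt0 : 0 < tau1 by rewrite lt_min ltr01 divr_gt0.
have [M' NM' tauM'] := tau_lt _ tau1_gt0.
have [v xv [+ _]] := tauM' _ (leq_maxr M M'); set k := maxn M M' in xv *.
have Mk : (M <= k)%N := leq_maxl _ _.
have Nk : (N <= k)%N := leq_trans NM Mk.
apply/negP; rewrite -leNgt.
have [_ Lk] := gcg_invariant k.+1.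
(* At a zero direction the quotient would default to [0] and the lower bound would fail; a positive
   gap excludes this. *)
have d0 : 0 < `|v - x k|.
  by apply: gap_gt0_neq xv _ => //; rewrite (lt_le_trans delta0)// gap_ge.
have p0 : 0 < 2 * L k.+1 * `|v - x k| ^+ 2.
  by rewrite mulr_gt0 ?exprn_gt0// mulr_gt0.
rewrite /tau /trial_tau le_min ge_min lexx/= ge_min; apply/orP; right.
apply: ler_pM; rewrite ?invr_ge0 ?gap_ge//; try exact: ltW.
rewrite lef_pV2 ?posrE//; apply: ler_pM; rewrite ?sqr_ge0//.
- by rewrite mulr_ge0// ltW.
- by rewrite ler_pM2l// L_le// (leq_trans Mk).
- by rewrite ler_pXn2r ?nnegrE// ?KB// ltW.
Qed.

(** * Passage to the limit *)

Lemma dot_gradient_near (p y : E) (e : R) : domain g p -> 0 < e ->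
  \forall z \near p, domain g z -> dot (h z) (y - z) <= dot (h p) (y - p) + e.
Proof.
(* For [z] within [eta <= 1] of [p], the change of gradient costs at most [eta * (|y - p| + 1)] and
   the change of point at most [eta * |h p|]. *)
move=> Dp e0; pose S := `|y - p| + 1 + `|h p|.
have S0 : 0 < S by rewrite ltr_pwDl// ltr_wpDl.
pose eta := Num.min 1 (e / S).
have eta0 : 0 < eta by rewrite lt_min ltr01 divr_gt0.
have eta1 : eta <= 1 by rewrite ge_min lexx.
have etaS : eta * S <= e by rewrite -ler_pdivlMr// ge_min lexx orbT.
have /subspace_continuousP/(_ p Dp)/cvgrPdist_le/(_ _ eta0) := f_C1.2.
rewrite near_withinE => hp; near=> z => Dz.
have hz : `|h z - h p| <= eta.
  by rewrite distrC; move: Dz; near: z; exact: hp.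
have zp : `|p - z| <= eta by near: z; apply: cvgr_dist_le.
have -> : dot (h z) (y - z)
    = dot (h p) (y - p) + (dot (h z - h p) (y - z) + dot (h p) (p - z)).
  by rewrite dotBl !dotBr; ring.
rewrite lerD2l (le_trans _ etaS)// /S mulrDr lerD//.
  rewrite (le_trans (dot_le_norm dot E_norm _ _))// ler_pM//.
  rewrite -(subrKA p) (le_trans (ler_normD _ _))// lerD2l.
  exact: le_trans zp eta1.
by rewrite (le_trans (dot_le_norm dot E_norm _ _))// mulrC ler_wpM2r.
Unshelve. all: by end_near. Qed.

Lemma stationary_cluster :
  exists p, cluster (x @ \oo) p /\ stationary_point dot f g p.
Proof.
(* The selection [s] need not be increasing: [n <= s n] is enough for a cluster point of [x \o s] to
   be one of [x]. *)
have /choice[s sP] n : exists k, (n <= k)%N /\ gap (x k) < n.+1%:R^-1.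
  have n0 : 0 < n.+1%:R^-1 :> R by rewrite invr_gt0.
  by have [k nk gk] := gap_small _ n n0; exists k.
have [|p [Kp clp]] := K_compact ((x \o s) @ \oo) _.
  by exists 0%N => // n _; exact: xK.
have Dp := K_domain _ Kp.
exists p; split.
  move=> A B [N _ NA] pB; apply: clp pB; exists N => // n /= Nn.
  by apply: NA => /=; rewrite (leq_trans Nn)// (sP n).1.
split=> // y; rewrite dotC dotNr -dotC.
have [gy|Dy] := eqVneq (g y) +oo%E; first by rewrite gy leey.
have {}Dy : domain g y by rewrite /domain /= ltey.
suff main (e : R) : 0 < e -> (g p <= (gr y + dot (h p) (y - p) + e)%:E)%E.
  rewrite (g_fine _ Dp) (g_fine _ Dy) -EFinD lee_fin.
  rewrite lerBlDr; apply/ler_addgt0Pr => e e0.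
  by have := main e e0; rewrite (g_fine _ Dp) lee_fin.
move=> e0; have e2 : 0 < e / 2 by rewrite divr_gt0.
(* Closedness of a level set of [g] reduces the bound at [p] to points [z] arbitrarily close to it.
   At an iterate with gap below [e / 2], optimality of [v] against [y] gives it, the other [e / 2]
   paying for the gradient at [z]. *)
apply: (lsc_level_closed g _ (closed_fun_lsc _ g_closed)) => B pB.
have small : \forall n \near \oo, gap (x (s n)) < e / 2.
  near=> n; rewrite (lt_trans (sP n).2)//; near: n.
  exact: near_infty_natSinv_lt (PosNum e2).
have smallF : ((x \o s) @ \oo) [set z | domain g z /\ gap z < e / 2 /\ exists v, lmo z v].
  apply: filterS small => n gn.
  by split; [exact: (K_domain _ (xK _))|split=> //; exact: gcg_lmo].
have [z [[Dz [gz [v zv]]] [Bz hz]]] :=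
  clp _ _ smallF (filterI pB (dot_gradient_near _ y _ Dp e2)).
exists z; split=> //=; rewrite (g_fine _ Dz) lee_fin.
have := (lmoP _ _ Dz zv).2 y Dy; have := hz Dz.
by move: gz; rewrite (gapE _ v)// !(dotBr _ (h z)); lra.
Unshelve. all: by end_near. Qed.

(** The running minimum is nonnegative and at most every gap already met, so a single gap below [e]
    bounds all later minima. The range [l < k.+1] is never empty, which keeps the minimum finite. *)
Lemma min_gap_cvg0 :
  (\big[mine/+oo%E]_(l < k.+1) fw_gap dot f g (x l)) @[k --> \oo] --> 0%E.
Proof.
have gapE_k k : fw_gap dot f g (x k) = (gap (x k))%:E.
  by have [v xv] := gcg_lmo k; rewrite (fw_gap_fine _ v)//; exact: (K_domain _ (xK k)).
pose u k := (\big[mine/+oo%E]_(l < k.+1) fw_gap dot f g (x l))%E.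
have u_ge0 k : (0 <= u k)%E.
  apply: (big_ind (fun a => 0 <= a)%E) => // [a b a0 b0|l _]; first by rewrite le_min a0.
  by rewrite gapE_k lee_fin gcg_gap_ge0.
have u_le k l : (l <= k)%N -> (u k <= (gap (x l))%:E)%E.
  rewrite -ltnS => lk; rewrite -gapE_k.
  exact: (bigmin_le_cond _ (fun l : 'I_k.+1 => fw_gap dot f g (x l))
    (j := Ordinal lk)).
have u_fin k : u k \is a fin_num.
  by rewrite ge0_fin_numE// (le_lt_trans (u_le k k _))// ltry.
apply/fine_cvgP; split; first by near=> k; exact: u_fin.
apply/cvgr0Pnorm_le => e e0.
have [l _ gl] := gap_small e 0 e0.
near=> k; rewrite /= -/(u k) ger0_norm; last exact/fine_ge0/u_ge0.
rewrite -lee_fin fineK; last exact: u_fin.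
rewrite (le_trans (u_le k l _))//; last by rewrite lee_fin ltW.
by near: k; exact: nbhs_infty_ge.
Unshelve. all: by end_near. Qed.

End conditional_gradient.

Theorem theorem3p2 (R : realType) (E : normedModType R)
    (dot : {dot E for idfun})
    (E_finite : finite_dimensional E)
    (E_norm : norm_induced_by dot)
    (f g : E -> \bar R)
    (f_range : never_ninfty f)
    (f_lsc : lower_semicontinuous f)
    (f_C1 : continuously_differentiable_on dot f (domain g))
    (g_proper : proper_fun g)
    (g_closed : closed_fun g)
    (g_convex : convex_fun g)
    (g_supercoercive : supercoercive g)
    (F_bounded_below : bounded_below (f \+ g)%E)
    (x0 : E) (x0_dom : domain g x0)
    (level_bounded : bounded_set [set x | ((f \+ g) x <= (f \+ g) x0)%E])
    (Linit : R) (Linit_gt0 : 0 < Linit)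
    (x : nat -> E)
    (x_gcg : gcg_sequence dot f g x0 Linit x) :
  (exists xstar : E,
     cluster (x @ \oo) xstar /\ stationary_point dot f g xstar) /\
  (\big[mine/+oo%E]_(l < k.+1) fw_gap dot f g (x l)) @[k --> \oo] --> 0%E.
Proof.
have [x_0 [L [L_0 x_step]]] := x_gcg.
have Dx0 : domain g (x 0%N) by rewrite x_0.
have L0 : 0 < L 0%N by rewrite L_0.
have inv := gcg_invariant dot f g f_C1 g_proper g_convex x L Dx0 L0 x_step.
have FE y : domain g y -> (f \+ g)%E y = (fine (f y) + fine (g y))%:E.
  move=> Dy /=; rewrite {1}(f_fine dot f g f_C1 y Dy).
  by rewrite {1}(g_fine g g_proper y Dy).
pose K := [set y | ((f \+ g) y <= (f \+ g) x0)%E].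
have K_compact : compact K.
  apply: (closed_bounded_compact dot E_norm E_finite) => //.
  rewrite /K FE//; apply: lsc_level_closed.
  apply: lower_semicontinuousD => //; [exact: g_proper.1|exact: closed_fun_lsc].
have K_domain : K `<=` domain g.
  (* Since [f] avoids [-oo], an infinite [g y] would make the sum infinite, above its finite value
     at [x0]. *)
  move=> y; rewrite /K /mkset (FE x0)// => yK.
  rewrite /domain /= ltey; apply: contraTneq yK => /= ->.
  by rewrite addey// leye_eq.
have xK k : K (x k).
  have := gcg_antitone dot f g f_C1 g_proper g_convex x L Dx0 L0 x_step _ _ (leq0n k).
  by rewrite /K /mkset -x_0 !FE ?lee_fin//; have [] := inv k.
have [m Fm] := F_bounded_below.
have Fr_ge k : m <= fine (f (x k)) + fine (g (x k)).
  by rewrite -lee_fin -FE//; have [] := inv k.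
split.
  exact: (stationary_cluster dot E_finite E_norm f g f_C1 g_proper g_closed
    g_convex g_supercoercive K K_compact K_domain x L Dx0 L0 x_step xK m Fr_ge).
exact: (min_gap_cvg0 dot E_finite E_norm f g f_C1 g_proper
    g_convex g_supercoercive K K_compact K_domain x L Dx0 L0 x_step xK m Fr_ge).
Qed.
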